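(* The optimal density of a $(3,1)$ broadcast for $H_{\infty,\infty}$ satisfies \[\delta_{3,1}(H_{\infty,\infty})\leq \frac{1}{8}.\]
   Context: The infinite truncated square tiling graph $H_{\infty,\infty}$ has vertex set $\{(a,(x,y)) : a\in\mathbb{Z}_4,\ (x,y)\in\mathbb{Z}^2\}$. Its edges are: $(a,(x,y))\sim(a+1,(x,y))$ with $a+1$ taken modulo 4 (so each $(x,y)$ carries a 4-cycle whose vertices $0,1,2,3$ are its top, right, bottom, left vertices); $(1,(x,y))\sim(3,(x+1,y))$; and $(0,(x,y))\sim(2,(x,y+1))$. For $(x,y)\in\mathbb{Z}^2$ the octagon $O_{x,y}$ is the 8-cycle through $(0,(x,y)),(1,(x,y)),(3,(x+1,y)),(0,(x+1,y)),(2,(x+1,y+1)),(3,(x+1,y+1)),(1,(x,y+1)),(2,(x,y+1))$, in this cyclic order. For a graph $G$ and integers $1\le r\le t$, a set $T\subseteq V(G)$ is a $(t,r)$ broadcast of $G$ if every $u\in V(G)$ satisfies $\sum_{v\in T,\ d(u,v)<t}(t-d(u,v))\ge r$, where $d$ is the graph distance in $G$. The broadcast density of a $(t,r)$ broadcast $T$ for $H_{\infty,\infty}$ is $\lim_{n\to\infty}|T\cap V(B_n)|/|V(B_n)|$, where $B_n$ is the finite portion of the graph given by the union of the octagons $O_{x,y}$ with $-n\le x,y\le n-1$. The optimal density $\delta_{t,r}(H_{\infty,\infty})$ is the minimum (infimum) of the broadcast densities over all $(t,r)$ broadcasts $T$ of $H_{\infty,\infty}$ for which the limit exists. *)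

(* Defs.v *)
From HB Require Import structures.
From mathcomp Require Import all_boot all_order all_algebra.
From mathcomp Require Import finmap zify.
From mathcomp Require Import all_classical all_reals all_analysis.

Set Implicit Arguments.
Unset Strict Implicit.
Unset Printing Implicit Defensive.

Import Order.TTheory GRing.Theory Num.Theory.
Import numFieldNormedType.Exports.
Local Open Scope classical_set_scope.
Local Open Scope ring_scope.

(* A graph is given by its vertex type V and its adjacency relation.  Distances
   live in \bar R, so that vertices in different components are at distance
   +oo. *)
Definition graph_dist (R : realType) (V : choiceType) (adj : rel V) (u v : V) :
    \bar R :=
  ereal_inf [set (size p)%:R%:E | p in [set p | path adj u p /\ last u p = v]].

(* The sum is over a possibly infinite set of nonnegative terms, hence esum. *)
Definition is_broadcast (R : realType) (V : choiceType) (adj : rel V)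
    (t r : nat) (T : set V) : Prop :=
  forall u : V,
    (r%:R%:E <=
     \esum_(v in [set v | T v /\ graph_dist R adj u v < t%:R%:E])
        (t%:R%:E - graph_dist R adj u v))%E.

Definition vertex : choiceType := ('Z_4 * (int * int))%type.

(* Each edge in one orientation only. *)
Definition tst_arc (u v : vertex) : bool :=
  let: (a, (x, y)) := u in let: (b, (x', y')) := v in
  [|| [&& b == a + 1, x' == x & y' == y],
      [&& a == 1, b == 3, x' == x + 1 & y' == y] |
      [&& a == 0, b == 2, x' == x & y' == y + 1]].

Definition tst_adj : rel vertex := fun u v => tst_arc u v || tst_arc v u.

Definition octagon (x y : int) : seq vertex :=
  [:: (0, (x, y)); (1, (x, y)); (3, (x + 1, y)); (0, (x + 1, y));
      (2, (x + 1, y + 1)); (3, (x + 1, y + 1)); (1, (x, y + 1));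
      (2, (x, y + 1))].

Lemma tst_adj_sym : symmetric tst_adj.
Proof. by move=> u v; rewrite /tst_adj orbC. Qed.

Lemma tst_adj_irr : irreflexive tst_adj.
Proof.
move=> [a [x y]]; rewrite /tst_adj orbb /=.
by case: a => [[|[|[|[|a]]]] lta] //=; rewrite ?andbF.
Qed.

Lemma octagon_cycle x y : cycle tst_adj (octagon x y).
Proof. by rewrite /= /tst_adj /tst_arc !eqxx /= ?orbT. Qed.

Definition block_vertices (n : nat) : set vertex :=
  [set v | exists x y : int,
    [/\ - n%:Z <= x <= n%:Z - 1, - n%:Z <= y <= n%:Z - 1 & v \in octagon x y]].

(* fset_set is meaningful on finite sets only. *)
Lemma finite_block_vertices n : finite_set (block_vertices n).
Proof.
pose I : seq int := [seq k%:Z - n%:Z | k <- iota 0 n.*2].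
have inI (x : int) : - n%:Z <= x <= n%:Z - 1 -> x \in I.
  move=> /andP[lx ux]; apply/mapP; exists (absz (x + n%:Z)).
    rewrite mem_iota /=; lia.
  lia.
apply: (@sub_finite_set _ _
  [set` flatten [seq octagon x y | x <- I, y <- I]]); last exact: finite_seq.
move=> v [x [y [hx hy hv]]] /=; apply/flattenP; exists (octagon x y) => //.
by apply/allpairsP; exists (x, y); split => //=; apply: inI.
Qed.

Definition block_ratio (R : realType) (T : set vertex) (n : nat) : R :=
  (#|` fset_set (T `&` block_vertices n)|)%fset%:R /
  (#|` fset_set (block_vertices n)|)%fset%:R.

Definition has_broadcast_density (R : realType) (T : set vertex) (d : R) : Prop :=
  block_ratio R T n @[n --> \oo] --> d.

(* The infimum is taken in \bar R. *)
Definition optimal_density (R : realType) (t r : nat) : \bar R :=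
  ereal_inf [set d%:E | d in
    [set d : R | exists T : set vertex,
       is_broadcast R tst_adj t r T /\ has_broadcast_density T d]].

(* Main.v *)
Require Import Defs.
From mathcomp Require Import all_boot all_order all_algebra.
From mathcomp Require Import finmap zify ring lra.
From mathcomp Require Import all_classical all_reals all_analysis.
Import Order.TTheory GRing.Theory Num.Theory.
Import numFieldNormedType.Exports.
Local Open Scope ring_scope.

(** The infimum is at most the density of any single (3,1) broadcast, so it
suffices to exhibit one of density 1/8.  A vertex contributes at least 1 to
another one exactly when their distance is at most 2, so a (3,1) broadcast is
the same thing as a set of vertices dominating the graph within distance 2
([dominating_broadcast]).

Give each square (x, y) the colour x + y modulo 4, and put one tower on each
even square: at its top vertex when the colour is 0, at its right vertex when
the colour is 2 ([towers]).  A tower covers its own square, the three vertices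
nearest to it in the square that it faces, and one vertex of each of the two
squares at its sides.  A square of colour 1 is faced by the top tower of the
square below it, which leaves out only the top vertex; the square above
carries a right tower, which covers that vertex sideways.  A square of colour
3 is in the same situation with the square at its left, of colour 2, and the
square at its right, of colour 0.  Hence the towers dominate
([towers_dominating]).

There is one tower for two squares, hence for eight vertices.  To make this
precise in a finite block, the even squares are parametrized by all pairs of
integers ([tower_at]); block and towers are then both squeezed between boxes of
integer points whose sizes differ by a term linear in the side of the block,
while the block itself grows quadratically ([block_ratio_dist]). *)

(** * Distance domination and broadcasts *)

(** A single broadcasting vertex within distance t suffices, since one term
bounds the sum of nonnegative terms from below. *)
Lemma dominating_broadcast (R : realType) (V : choiceType) (adj : rel V)
    (t : nat) (T : set V) :
  (forall u, exists v p, [/\ T v, path adj u p, last u p = v & (size p <= t)%N]) ->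
  is_broadcast R adj t.+1 1 T.
Proof.
move=> dom u; have [v [p [Tv up pv sp]]] := dom u.
have dle : (graph_dist R adj u v <= t%:R%:E)%E.
  apply: (@le_trans _ _ (size p)%:R%:E); last by rewrite lee_fin ler_nat.
  by apply: ereal_inf_lbound; exists p.
have dge : (0 <= graph_dist R adj u v)%E.
  by apply: le_ereal_inf_tmp => _ [q _ <-]; rewrite lee_fin.
apply: esum_ge; exists [set v]%classic.
  split; first exact: finite_set1.
  move=> _ ->; split => //; apply: le_lt_trans dle _.
  by rewrite lte_fin ltr_nat.
rewrite fsbig_set1.
case: (graph_dist R adj u v) dle dge => [d| |] //.
by rewrite -EFinB !lee_fin => dle _; rewrite -natr1; lra.
Qed.

(** * The towers *)

Definition towers : set vertex :=
  [set v | (v.1 = 0 /\ ((v.2.1 + v.2.2) %% 4)%Z = 0) \/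
           (v.1 = 1 /\ ((v.2.1 + v.2.2) %% 4)%Z = 2)]%classic.

Ltac walk_tac := first
 [ by [] | by rewrite /= /tst_adj /tst_arc ?subrK !eqxx /= ?orbT
 | by move=> ?; left; split => //; lia | by move=> ?; right; split => //; lia ].

(** For each vertex of a square and each colour of the square, a path to a tower
is given explicitly; only odd squares need towers of neighbouring squares. *)
Lemma towers_dominating (u : vertex) :
  exists v p, [/\ towers v, path tst_adj u p, last u p = v & (size p <= 2)%N].
Proof.
suff [p [Tp up sp]] : exists p : seq vertex,
    [/\ towers (last u p), path tst_adj u p & (size p <= 2)%N].
  by exists (last u p), p.
have walk (p : seq vertex) (b : 'Z_4) (x y : int) : last u p = (b, (x, y)) ->
    path tst_adj u p -> (size p <= 2)%N ->
    (b = 0 /\ ((x + y) %% 4)%Z = 0) \/ (b = 1 /\ ((x + y) %% 4)%Z = 2) ->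
    exists p : seq vertex,
      [/\ towers (last u p), path tst_adj u p & (size p <= 2)%N].
  by move=> pE up sp bxy; exists p; rewrite pE.
case: u walk => a [x y] walk.
have : ((x + y) %% 4)%Z \in [:: 0; 1; 2; 3] by rewrite !inE; lia.
have : a \in [:: 0; 1; 2; 3] by case: a {walk} => -[|[|[|[|a]]]].
rewrite !inE => /or4P[] /eqP aE /or4P[] /eqP xyE; rewrite {}aE in walk *.
- by apply: (walk [::] 0 x y); move: xyE; walk_tac.
- by apply: (walk [:: (2, (x, y + 1)); (1, (x, y + 1))] 1 x (y + 1)); move: xyE; walk_tac.
- by apply: (walk [:: (1, (x, y))] 1 x y); move: xyE; walk_tac.
- by apply: (walk [:: (3, (x, y)); (1, (x - 1, y))] 1 (x - 1) y); move: xyE; walk_tac.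
- by apply: (walk [:: (0, (x, y))] 0 x y); move: xyE; walk_tac.
- by apply: (walk [:: (2, (x, y)); (0, (x, y - 1))] 0 x (y - 1)); move: xyE; walk_tac.
- by apply: (walk [::] 1 x y); move: xyE; walk_tac.
- by apply: (walk [:: (3, (x + 1, y)); (0, (x + 1, y))] 0 (x + 1) y); move: xyE; walk_tac.
- by apply: (walk [:: (1, (x, y)); (0, (x, y))] 0 x y); move: xyE; walk_tac.
- by apply: (walk [:: (0, (x, y - 1))] 0 x (y - 1)); move: xyE; walk_tac.
- by apply: (walk [:: (1, (x, y))] 1 x y); move: xyE; walk_tac.
- by apply: (walk [:: (3, (x, y)); (1, (x - 1, y))] 1 (x - 1) y); move: xyE; walk_tac.
- by apply: (walk [:: (0, (x, y))] 0 x y); move: xyE; walk_tac.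
- by apply: (walk [:: (2, (x, y)); (0, (x, y - 1))] 0 x (y - 1)); move: xyE; walk_tac.
- by apply: (walk [:: (2, (x, y)); (1, (x, y))] 1 x y); move: xyE; walk_tac.
- by apply: (walk [:: (1, (x - 1, y))] 1 (x - 1) y); move: xyE; walk_tac.
Qed.

(** * Counting *)

Lemma card_fset_set_le (T : choiceType) (A : set T) (s : seq T) :
  {subset A <= s} -> (#|` fset_set A| <= size s)%N.
Proof.
move=> As; have finA : finite_set A.
  by apply: (@sub_finite_set _ _ [set` s]%classic) (finite_seq s) => x xA;
    apply/As/mem_set.
by apply: uniq_leq_size (fset_uniq _) _ => x; rewrite in_fset_set // => /As.
Qed.

Lemma card_fset_set_ge (T : choiceType) (A : set T) (s : seq T) :
  finite_set A -> uniq s -> {subset s <= A} -> (size s <= #|` fset_set A|)%N.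
Proof.
move=> finA us sA; apply: uniq_leq_size us _ => x /sA.
by rewrite in_fset_set.
Qed.

(** Half-open intervals and boxes keep all the sizes even and free of truncated
subtractions. *)
Definition interval_seq (r : nat) : seq int :=
  [seq k%:Z - r%:Z | k <- iota 0 r.*2].

Definition box (r s : nat) : seq (int * int) :=
  [seq (x, k) | x <- interval_seq r, k <- interval_seq s].

Lemma mem_interval_seq r x : (x \in interval_seq r) = (- r%:Z <= x < r%:Z).
Proof.
apply/mapP/idP => [[k] | xr]; first by rewrite mem_iota => kr ->; lia.
by exists (absz (x + r%:Z)); [rewrite mem_iota | ]; lia.
Qed.

Lemma mem_box r s x k :
  ((x, k) \in box r s) = (- r%:Z <= x < r%:Z) && (- s%:Z <= k < s%:Z).
Proof.
rewrite -!mem_interval_seq; apply/allpairsP/andP => [[[x' k'] /= [? ? [-> ->]]] //|].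
by move=> [xr ks]; exists (x, k).
Qed.

Lemma interval_seq_uniq r : uniq (interval_seq r).
Proof. by rewrite map_inj_uniq ?iota_uniq // => k l; lia. Qed.

Lemma box_uniq r s : uniq (box r s).
Proof. by apply: allpairs_uniq; [exact: interval_seq_uniq.. | move=> [? ?] [? ?]]. Qed.

Lemma size_box r s : size (box r s) = (r.*2 * s.*2)%N.
Proof. by rewrite size_allpairs !size_map !size_iota. Qed.

(** The even squares of column x are those of height 2k + (x mod 2). *)
Definition tower_at (c : int * int) : vertex :=
  let y := 2 * c.2 + (c.1 %% 2)%Z in
  (if ((c.1 + y) %% 4)%Z == 0 then 0 else 1, (c.1, y)).

Lemma tower_at_inj : injective tower_at.
Proof. by move=> [x k] [x' k'] [_ -> e]; congr pair; lia. Qed.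

Lemma towers_tower_at c : towers (tower_at c).
Proof.
case: c => x k; rewrite /towers /tower_at /=.
by case: eqP => e; [left | right]; split => //; lia.
Qed.

Lemma tower_atP v : towers v -> exists c, v = tower_at c.
Proof.
case: v => a [x y] T; exists (x, ((y - (x %% 2)%Z) %/ 2)%Z).
rewrite /tower_at /=; move: T; rewrite /towers /= => T.
have -> : 2 * ((y - (x %% 2)%Z) %/ 2)%Z + (x %% 2)%Z = y by case: T => -[_]; lia.
by case: T => -[-> ->].
Qed.

Lemma block_verticesS_sub n a x y :
  block_vertices n.+1 (a, (x, y)) -> (x, y) \in box n.+2 n.+2.
Proof.
move=> [x' [y' [hx hy]]]; rewrite mem_box !inE.
by do !case/orP; move=> /eqP[_ -> ->]; lia.
Qed.

(** Top and right vertices of a square lie on the octagon of the same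
coordinates, bottom and left ones on the octagon diagonally below. *)
Lemma sub_block_verticesS n a x y :
  - n%:Z <= x <= n%:Z -> - n%:Z <= y <= n%:Z -> block_vertices n.+1 (a, (x, y)).
Proof.
move=> hx hy; have : a \in [:: 0; 1; 2; 3] by case: a => -[|[|[|[|a]]]].
rewrite !inE => /or4P[] /eqP ->.
- by exists x, y; split; [lia.. | rewrite !inE eqxx].
- by exists x, y; split; [lia.. | rewrite !inE eqxx ?orbT].
- by exists (x - 1), (y - 1); split; [lia.. | rewrite !inE !subrK eqxx ?orbT].
- by exists (x - 1), (y - 1); split; [lia.. | rewrite !inE !subrK eqxx ?orbT].
Qed.

Definition squares_vertices (s : seq (int * int)) : seq vertex :=
  [seq (a, c) | a <- enum 'Z_4, c <- s].

Lemma size_squares_vertices s : size (squares_vertices s) = (4 * size s)%N.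
Proof. by rewrite size_allpairs -cardE card_ord. Qed.

Lemma card_block_le n :
  (#|` fset_set (block_vertices n.+1)| <= 4 * (n.+2.*2 * n.+2.*2))%N.
Proof.
rewrite -size_box -size_squares_vertices; apply: card_fset_set_le.
move=> [a [x y]] /set_mem /block_verticesS_sub xy.
by apply/allpairsP; exists (a, (x, y)); rewrite mem_enum.
Qed.

Lemma card_block_ge n :
  (4 * (n.*2 * n.*2) <= #|` fset_set (block_vertices n.+1)|)%N.
Proof.
rewrite -size_box -size_squares_vertices; apply: card_fset_set_ge.
- exact: finite_block_vertices.
- apply: allpairs_uniq (enum_uniq _) (box_uniq _ _) _.
  by move=> [a c] [a' c'] _ _ [-> ->].
- move=> _ /allpairsP[[a [x y]] [_ /= xy ->]]; apply/mem_set.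
  by apply: sub_block_verticesS; rewrite mem_box in xy; lia.
Qed.

(** The second coordinate of the box is halved because consecutive towers of a
column are two squares apart; rounding costs at most one of them at each end. *)
Lemma card_towers_le n :
  (#|` fset_set (towers `&` block_vertices n.+1)| <= n.+2.*2 * n.+3)%N.
Proof.
pose s := map tower_at (box n.+2 n.+3./2).
apply: (@leq_trans (size s)); last by rewrite size_map size_box leq_mul2l; lia.
apply: card_fset_set_le => v /set_mem[/tower_atP[[x k] ->] /block_verticesS_sub].
rewrite mem_box /= => xy; apply: map_f; rewrite mem_box.
by have := odd_double_half n.+3; lia.
Qed.

Lemma card_towers_ge n :
  (n.*2 * n.-1 <= #|` fset_set (towers `&` block_vertices n.+1)|)%N.
Proof.
pose s := map tower_at (box n n./2).
apply: (@leq_trans (size s)); first by rewrite size_map size_box leq_mul2l; lia.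
apply: card_fset_set_ge.
- by apply: finite_setIr; exact: finite_block_vertices.
- by rewrite map_inj_uniq ?box_uniq //; exact: tower_at_inj.
- move=> _ /mapP[[x k] xk ->]; apply/mem_set; split; first exact: towers_tower_at.
  rewrite mem_box in xk; have nE := odd_double_half n.
  by apply: sub_block_verticesS; rewrite /=; lia.
Qed.

(** * The density *)

Lemma ratio_dist (R : realFieldType) (t b m : R) : 0 < b -> 0 < m ->
    8 * t * m <= b * m + 96 * b -> b * m <= 8 * t * m + 96 * b ->
  `|t / b - 1 / 8| <= 12 / m.
Proof.
move=> b0 m0 up lo; have bm0 : 0 <= (8 * b * m)^-1.
  by rewrite invr_ge0 !mulr_ge0 // ltW.
have [b_neq0 m_neq0] : b != 0 /\ m != 0 by rewrite !gt_eqF.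
rewrite ler_norml; apply/andP; split; rewrite -subr_ge0.
- have -> : t / b - 1 / 8 - - (12 / m) =
      (8 * t * m + 96 * b - b * m) * (8 * b * m)^-1.
    by field; apply/andP.
  by rewrite mulr_ge0 ?subr_ge0.
- have -> : 12 / m - (t / b - 1 / 8) =
      (b * m + 96 * b - 8 * t * m) * (8 * b * m)^-1.
    by field; apply/andP.
  by rewrite mulr_ge0 ?subr_ge0.
Qed.

(** The bounds on 8 times the number of towers and on the number of vertices
differ by a term linear in n, and the block has at least 16 (n + 1) ^ 2
vertices; the constant 12 is a rough bound for the quotient. *)
Lemma block_ratio_dist (R : realType) n :
  `|block_ratio R towers n.+2 - 1 / 8| <= 12 * harmonic n.+2.
Proof.
have := card_block_le n.+1; have := card_block_ge n.+1.
have := card_towers_le n.+1; have := card_towers_ge n.+1.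
rewrite /block_ratio /harmonic; set t := #|` _|; set b := #|` _| => t1 t2 b1 b2.
apply: ratio_dist; first by rewrite ltr0n; lia.
- by rewrite ltr0n.
- by rewrite -!natrM -natrD ler_nat; nia.
- by rewrite -!natrM -natrD ler_nat; nia.
Qed.

Lemma towers_density (R : realType) : has_broadcast_density towers (1 / 8 : R).
Proof.
have h0 : (12 * @harmonic R n @[n --> \oo] --> 0)%classic.
  by rewrite -(mulr0 12); apply: cvgMr; exact: cvg_harmonic.
apply: (squeeze_cvgr (f := fun n => 1 / 8 - 12 * harmonic n)
          (h := fun n => 1 / 8 + 12 * harmonic n)).
- near=> n; have n1 : (1 < n)%N by near: n; exact: nbhs_infty_gt.
  rewrite -ler_distl; case: (n) n1 => [|[|m]] // _; exact: block_ratio_dist.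
- by rewrite -{2}(subr0 (1 / 8 : R)); apply: cvgB h0; exact: cvg_cst.
- by rewrite -{2}(addr0 (1 / 8 : R)); apply: cvgD h0; exact: cvg_cst.
Unshelve. all: by end_near. Qed.

Theorem theorem4p4 (R : realType) :
  (optimal_density R 3 1 <= (1 / 8)%:E)%E.
Proof.
apply: ereal_inf_lbound; exists (1 / 8) => //; exists towers; split.
- exact/dominating_broadcast/towers_dominating.
- exact: towers_density.
Qed.
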